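(* For every finite simple graph $G$ and every positive integer $t$, $\pi^{c}(G\,\Box\, K_t)\le t\,\pi^{c}(G)$.
   Context: The Cartesian product $G\,\Box\,H$ has vertex set $V(G)\times V(H)$, with $(u,v)$ adjacent to $(w,x)$ iff either $uw\in E(G)$ and $v=x$, or $u=w$ and $vx\in E(H)$. $K_t$ is the complete graph on $t$ vertices. A configuration of cops on a graph is a function $C$ from its vertices to $\mathbb{Z}_{\ge 0}$ of size $\sum_v C(v)$. A pebbling step from a vertex $u$ with at least two cops to an adjacent vertex $v$ removes two cops from $u$ and adds one cop to $v$. In the cops and robbers pebbling game, cops are placed according to $C$, then a robber chooses a starting vertex; thereafter, in each turn the cops make pebbling steps, after which the robber either moves to an adjacent vertex or stays put. The robber is captured when he occupies a vertex holding at least one cop. The cop pebbling number $\pi^{c}(G)$ is the minimum $m$ such that some configuration of size $m$ allows the cops to capture the robber regardless of how he starts and moves. *)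

(* Defs.v *)
From mathcomp Require Import all_boot boolp.
From Stdlib Require Import Relation_Operators.

Set Implicit Arguments.
Unset Strict Implicit.
Unset Printing Implicit Defensive.

Record sgraph := SGraph {
  vertex :> finType;
  adj : rel vertex;
  adj_sym : symmetric adj;
  adj_irrefl : irreflexive adj }.

Section CartesianProduct.
Variables G H : sgraph.

Definition box_adj : rel (G * H)%type := fun p q =>
  (adj p.1 q.1 && (p.2 == q.2)) || ((p.1 == q.1) && adj p.2 q.2).

Lemma box_adj_sym : symmetric box_adj.
Proof.
move=> p q; rewrite /box_adj (adj_sym p.1) (adj_sym p.2).
by rewrite (eq_sym p.1) (eq_sym p.2).
Qed.

Lemma box_adj_irrefl : irreflexive box_adj.
Proof. by move=> p; rewrite /box_adj !adj_irrefl andbF. Qed.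

Definition box : sgraph := SGraph box_adj_sym box_adj_irrefl.
End CartesianProduct.

Section Complete.
Variable t : nat.

Definition complete_adj : rel 'I_t := fun i j => i != j.

Lemma complete_adj_sym : symmetric complete_adj.
Proof. by move=> i j; rewrite /complete_adj eq_sym. Qed.

Lemma complete_adj_irrefl : irreflexive complete_adj.
Proof. by move=> i; rewrite /complete_adj eqxx. Qed.

Definition complete : sgraph := SGraph complete_adj_sym complete_adj_irrefl.
End Complete.

(* What "the cops make pebbling steps" allows within one turn:
   - [simultaneous]: finitely many steps (possibly none) made at the same time,
     so that every cop takes part in at most one step of the turn, as in the
     game of cops and robbers;
   - [sequential]: finitely many steps (possibly none) made one after the
     other, so that a cop that has just moved may be used again. A robber who
     stays put then faces exactly an optimal pebbling problem. *)
Variant turn_rule := simultaneous | sequential.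

Section Game.
Variable G : sgraph.

Definition config := {ffun G -> nat}.

Definition config_size (C : config) : nat := \sum_v C v.

Definition pebbling_step (C C' : config) : Prop :=
  exists u v : G, [/\ adj u v, 2 <= C u &
    C' = [ffun w => C w - 2 * (w == u) + (w == v)]].

(* The list s holds one pair (source, target) per step; the second condition
   says that the cops initially present pay for all the steps at once. *)
Definition simultaneous_steps (C C' : config) : Prop :=
  exists s : seq (G * G),
    [/\ all (fun e => adj e.1 e.2) s,
        forall w, 2 * count (fun e => e.1 == w) s <= C w &
        C' = [ffun w => C w - 2 * count (fun e => e.1 == w) s
                            + count (fun e => e.2 == w) s]].

Definition cop_turn (rule : turn_rule) : config -> config -> Prop :=
  match rule with
  | simultaneous => simultaneous_steps
  | sequential => clos_refl_trans config pebbling_step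
  end.

(* r n is the position of the robber after n of his moves. *)
Definition robber_walk (r : nat -> G) : Prop :=
  forall n, r n.+1 = r n \/ adj (r n) (r n.+1).

(* A strategy maps the list of the robber's positions so far to the
   configuration that results from the cops' next turn. *)
Definition strategy := seq G -> config.

Definition play (C : config) (sigma : strategy) (r : nat -> G) (n : nat) :
    config :=
  if n is m.+1 then sigma (mkseq r m.+1) else C.

(* The robber at r n is captured either before the cops' turn number n
   (he started at, or moved to, an occupied vertex) or by that turn. *)
Definition captured (C : config) (sigma : strategy) (r : nat -> G) : Prop :=
  exists n, 0 < play C sigma r n (r n) \/ 0 < play C sigma r n.+1 (r n).

Definition winning (rule : turn_rule) (C : config) : Prop :=
  exists sigma : strategy, forall r : nat -> G, robber_walk r ->
    (forall n, cop_turn rule (play C sigma r n) (play C sigma r n.+1)) /\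
    captured C sigma r.

Definition enough_cops (rule : turn_rule) (m : nat) : Prop :=
  exists C : config, config_size C = m /\ winning rule C.

Lemma cop_turn_refl rule C : cop_turn rule C C.
Proof.
case: rule => /=; last exact: rt_refl.
by exists [::]; split=> //; apply/ffunP=> w; rewrite ffunE /= muln0 subn0 addn0.
Qed.

Lemma enough_cops_ex rule : exists m, `[< enough_cops rule m >].
Proof.
pose C : config := [ffun => 1].
exists (config_size C); apply/asboolP; exists C; split=> //.
exists (fun=> C) => r _; split=> [[|n]|]; [exact: cop_turn_refl..|].
by exists 0; left; rewrite /= ffunE.
Qed.

Definition cop_pebbling_number (rule : turn_rule) : nat :=
  ex_minn (enough_cops_ex rule).
End Game.

(* Main.v *)
(** Copy a winning configuration of G, and the strategy for it, into each of
    the t layers G x {i}, answering the projection of the robber to G (which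
    again walks along edges of G or stays put).  When the projected robber is
    captured in G, every copy of his vertex is occupied, in particular the one
    in his own layer. *)
Require Import Defs.
From mathcomp Require Import all_boot boolp.
From Stdlib Require Import Relation_Operators.

Set Implicit Arguments.
Unset Strict Implicit.
Unset Printing Implicit Defensive.

Section Layers.
Variables (G H : sgraph).

Definition lift_config (C : config G) : config (box G H) :=
  [ffun p : G * H => C p.1].

Lemma lift_config_size C :
  config_size (lift_config C) = #|H| * config_size C.
Proof.
rewrite /config_size -sum_nat_const exchange_big pair_bigA /=.
by apply: eq_bigr => p _; rewrite ffunE.
Qed.

Definition lift_steps (s : seq (G * G)) :
    seq (box G H * box G H) :=
  [seq ((e.1, i), (e.2, i)) | e <- s, i <- enum H].

(* f stands for fst (source of a step) or snd (target). *)
Lemma count_lift_steps (f : forall T : Type, T * T -> T) s (w : box G H) :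
  (forall (e : G * G) (i : H), f _ ((e.1, i), (e.2, i)) = (f _ e, i)) ->
  count (fun e => f _ e == w) (lift_steps s) = count (fun e => f _ e == w.1) s.
Proof.
case: w => a j fE; rewrite /lift_steps.
elim: s => //= e s IHs; rewrite count_cat {}IHs count_map; congr (_ + _).
rewrite (eq_count (a2 := fun i => (f _ e == a) && (i == j))); last first.
  by move=> i; rewrite /= fE -pair_eqE.
case: (f _ e == a) => /=; last by rewrite count_pred0.
by rewrite (count_uniq_mem _ (enum_uniq H)) mem_enum.
Qed.

(** Copies in different layers draw on disjoint sets of cops, so they are paid for together once the
    original steps are paid for in [G]. *)
Lemma simultaneous_steps_lift (C C' : config G) :
  simultaneous_steps C C' ->
  simultaneous_steps (lift_config C) (lift_config C').
Proof.
case=> s [/allP adj_s le_s ->].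
have src w := @count_lift_steps (fun _ e => e.1) s w (fun _ _ => erefl).
have tgt w := @count_lift_steps (fun _ e => e.2) s w (fun _ _ => erefl).
exists (lift_steps s); split.
- apply/allP=> _ /allpairsP[[e i] /= [es _ ->]].
  by rewrite /box_adj /= (adj_s e es) eqxx.
- by move=> w; rewrite src ffunE.
- by apply/ffunP=> w; rewrite !ffunE src tgt.
Qed.

(** Sequential play moves one layer at a time, so a single step in [G] becomes a chain of [#|H|]
    steps. *)
Lemma pebbling_step_lift (C C' : config G) :
  pebbling_step C C' ->
  clos_refl_trans _ (@pebbling_step (box G H)) (lift_config C) (lift_config C').
Proof.
case=> u [v [uv Cu C'E]].
(* Intermediate configuration: exactly the layers in [s] have already made the step. *)
pose hybrid (s : seq H) : config (box G H) :=
  [ffun p : G * H => if p.2 \in s then C' p.1 else C p.1].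
have -> : lift_config C' = hybrid (enum H).
  by apply/ffunP=> p; rewrite !ffunE mem_enum.
elim: (enum H) (enum_uniq H) => [_|i s IHs /= /andP[i_s /IHs steps_s]].
  have -> : hybrid [::] = lift_config C by apply/ffunP=> p; rewrite !ffunE.
  exact: rt_refl.
(* Layer [i] is still untouched since [i] is not in [s], so [(u, i)] holds [C u] cops. *)
apply: rt_trans steps_s _; apply: rt_step; exists (u, i), (v, i); split.
- by rewrite /= /box_adj /= uv eqxx.
- by rewrite ffunE /= (negPf i_s).
- apply/ffunP=> -[a j]; rewrite !ffunE /= inE -!pair_eqE /=.
  have [->|_] := eqVneq j i; last by rewrite !andbF subn0 addn0.
  by rewrite (negPf i_s) C'E ffunE !andbT.
Qed.

Lemma cop_turn_lift rule (C C' : config G) :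
  cop_turn rule C C' -> cop_turn rule (lift_config C) (lift_config C').
Proof.
case: rule => /=; first exact: simultaneous_steps_lift.
elim=> [? ? step|?|? ? ? _ IH1 _ IH2].
- exact: pebbling_step_lift.
- exact: rt_refl.
- exact: rt_trans IH1 IH2.
Qed.

(** A move between layers projects to staying put. *)
Lemma robber_walk_proj (r : nat -> box G H) :
  robber_walk r -> robber_walk (fun n => (r n).1).
Proof.
move=> walk_r n; have [->|] := walk_r n; first by left.
by case/orP=> /andP[]; [right | move/eqP->; left].
Qed.

Lemma winning_lift rule (C : config G) :
  winning rule C -> winning rule (lift_config C).
Proof.
case=> sigma win.
pose tau (s : seq (box G H)) := lift_config (sigma (map fst s)).
exists tau => r /robber_walk_proj /win[turns capt].
(* The play remains a lift at every time, so legality of the turns and capture both carry over from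
   [G]. *)
have playE n : play (lift_config C) tau r n =
    lift_config (play C sigma (fun n => (r n).1) n).
  by case: n => //= n; rewrite /tau /= /mkseq -map_comp.
split=> [n|]; first by rewrite !playE; apply: cop_turn_lift.
by case: capt => n capt; exists n; rewrite !playE !ffunE.
Qed.

Lemma cop_pebbling_number_box rule :
  cop_pebbling_number (box G H) rule <= #|H| * cop_pebbling_number G rule.
Proof.
rewrite {2}/cop_pebbling_number.
(* [C] attains the minimum for [G]; its lift bounds the minimum for the product. *)
case: ex_minnP => _ /asboolP[C [<- winC]] _.
rewrite /cop_pebbling_number; case: ex_minnP => m _; apply; apply/asboolP.
exists (lift_config C); split; [exact: lift_config_size | exact: winning_lift].
Qed.

End Layers.

Theorem theorem13 (rule : turn_rule) (G : sgraph) (t : nat) (ht : 0 < t) :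
  cop_pebbling_number (box G (complete t)) rule <= t * cop_pebbling_number G rule.
Proof.
by have := cop_pebbling_number_box G (complete t) rule; rewrite card_ord.
Qed.
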